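(* For every $d \geq 1$, there exists an evenly distributed family $(X_i)_{i=1}^{\infty}$ of finite point sets in $B^d\subset\mathbb{R}^d$ with $L(X_i) = \Theta(|X_i|^{1/d})$ as $i\to\infty$.
   Context: $B^d$ denotes the closed Euclidean unit ball in $\mathbb{R}^d$ centered at the origin. For a set $A \subset \mathbb{R}^d$ (with at least two points), $\mu(A)$ denotes the minimum Euclidean distance between distinct points of $A$. Layer number: for a finite set $X \subset \mathbb{R}^d$, let $V(X)$ be the set of vertices (extreme points) of the convex hull $\mathrm{conv}\, X$. The peeling process starts with $X$ and in each step deletes from the current set all vertices of its convex hull, i.e. replaces the current set $Y$ by $Y \setminus V(Y)$, until the empty set is reached. The layer number $L(X)$ is the number of steps required to reach the empty set. Evenly distributed family: a family of finite sets $X_1, X_2, X_3, \dots \subset B^d$ is evenly distributed if $|X_i| \to \infty$ and $\mu(X_i) = \Theta(|X_i|^{-1/d})$ as $i\to\infty$, where the implied constants in $\Theta$ may depend on $d$ and on the family. The implied constants in the conclusion may depend on $d$ and on the constants in the asymptotic bound $\mu(X_i) = \Theta(|X_i|^{-1/d})$. *)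

(* Defs.v *)
From HB Require Import structures.
From mathcomp Require Import all_boot all_order all_algebra finmap.
From mathcomp Require Import ring lra.
From mathcomp Require Import all_classical all_reals all_analysis.

Set Implicit Arguments.
Unset Strict Implicit.
Unset Printing Implicit Defensive.

Import Order.TTheory GRing.Theory Num.Theory.
Import numFieldNormedType.Exports.

Local Open Scope classical_set_scope.
Local Open Scope ring_scope.

Section Euclidean.
Context {R : realType} {d : nat}.
Implicit Types (x y : 'rV[R]_d) (A : set 'rV[R]_d).

(* The library norm `|x| on 'rV[R]_d is the sup norm, hence this definition. *)
Definition euclidean_norm x : R := Num.sqrt (\sum_(i < d) x 0 i ^+ 2).

Definition euclidean_ball : set 'rV[R]_d := [set x | euclidean_norm x <= 1].

(* When A is finite with at least two points the infimum is attained (see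
   min_distE below); otherwise the value is not meaningful. *)
Definition min_dist A : R :=
  inf [set r | exists x y, [/\ A x, A y, x != y & r = euclidean_norm (x - y)]].

End Euclidean.

Section Convexity.
Context {R : realType} {E : lmodType R}.
Implicit Types (A C : set E).

Definition convex_hull A : set E := smallest (@convex_set R E) A.

Definition extreme_points C : set E :=
  [set x | C x /\ forall (a b : E) (t : R), C a -> C b -> 0 < t < 1 ->
     x = t *: a + (1 - t) *: b -> a = x /\ b = x].

End Convexity.

Section Peeling.
Context {R : realType} {d : nat}.
Implicit Types (X Y : {fset 'rV[R]_d}).

Definition hull_vertices X : set 'rV[R]_d :=
  extreme_points (convex_hull [set` X]).

Definition peel Y : {fset 'rV[R]_d} :=
  [fset y in Y | y \notin hull_vertices Y]%fset.

Let q (x : 'rV[R]_d) : R := \sum_(i < d) x 0 i ^+ 2.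

Let q_ge0 x : 0 <= q x.
Proof. by apply: sumr_ge0 => i _; rewrite sqr_ge0. Qed.

Let q_eq0 x : q x <= 0 -> x = 0.
Proof.
move=> qx0; have /eqP : q x = 0 by apply/eqP; rewrite eq_le qx0 q_ge0.
rewrite psumr_eq0 => [/allP h|i _]; last by rewrite sqr_ge0.
apply/rowP => i; rewrite mxE; apply/eqP.
by have := h i (mem_index_enum _); rewrite /= sqrf_eq0.
Qed.

Let q_comb (a b : 'rV[R]_d) t :
  q (t *: a + (1 - t) *: b) = t * q a + (1 - t) * q b - t * (1 - t) * q (a - b).
Proof.
rewrite /q !mulr_sumr -big_split -sumrB /=; apply: eq_bigr => i _.
rewrite !mxE; ring.
Qed.

Lemma hull_vertices_neq0 X : X != fset0 ->
  exists2 x, x \in X & x \in hull_vertices X.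
Proof.
case/fset0Pn => x0 x0X.
pose m := [arg max_(i > [` x0X]%fset) q (val i)]%O.
have mmax y : y \in X -> q y <= q (val m).
  move=> yX; rewrite /m; case: Order.TotalTheory.arg_maxP => //= i _.
  by move=> /(_ [` yX]%fset isT).
exists (val m); first exact: valP.
have sub : convex_hull [set` X] `<=` [set y | q y <= q (val m)].
  apply: smallest_sub => [|y /mmax//] a b l.
  rewrite !inE /= => qa qb; rewrite /conv /= q_comb.
  have l0 : 0 <= l%:num by [].
  have l1 : l%:num <= 1 by [].
  have := mulr_ge0 (mulr_ge0 l0 (_ : 0 <= 1 - l%:num)) (q_ge0 (a - b)).
  rewrite subr_ge0 => /(_ l1); move: (q _) => z; rewrite /=; nra.
rewrite inE; split.
  by apply: sub_gen_smallest => /=; exact: valP.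
move=> a b t /sub /= qa /sub /= qb /andP[t0 t1] e.
suff ab : a = b by move: e; rewrite ab -scalerDl addrC subrK scale1r => ->.
apply/eqP; rewrite -subr_eq0; apply/eqP; apply: q_eq0.
have := q_comb a b t; rewrite -e => qm.
have tt : 0 < t * (1 - t) by rewrite mulr_gt0// subr_gt0.
rewrite -(pmulr_rle0 _ tt); nra.
Qed.

Lemma peel_terminates X : exists n, iter n peel X == fset0.
Proof.
have [k] := ubnP #|` X|; elim: k X => // k IH X.
have [->|X0 kX] := eqVneq X fset0; first by exists 0%N => /=.
have [x xX xV] := hull_vertices_neq0 X0.
have : (#|` peel X| < k)%N.
  move: kX; rewrite ltnS; apply: leq_trans; apply: fproper_ltn_card.
  rewrite fproperE; apply/andP; split.
    by apply/fsubsetP => y; rewrite !inE => /andP[].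
  apply/fsubsetPn; exists x => //; rewrite !inE /= xX. by rewrite xV.
by move=> /IH[n hn]; exists n.+1; rewrite iterSr.
Qed.

Definition layer_number X : nat := ex_minn (peel_terminates X).

Lemma min_distE X : (1 < #|` X|)%N ->
  (exists x y, [/\ x \in X, y \in X, x != y &
     min_dist [set` X] = euclidean_norm (x - y)]) /\
  (forall x y, x \in X -> y \in X -> x != y ->
     min_dist [set` X] <= euclidean_norm (x - y)).
Proof.
have lb x y : x \in X -> y \in X -> x != y ->
    min_dist [set` X] <= euclidean_norm (x - y).
  move=> xX yX xy; apply: ge_inf; last by exists x, y.
  by exists 0 => _ [a [b [_ _ _ ->]]]; rewrite sqrtr_ge0.
move=> X1; split=> //.
have [x0 x0X] : exists x, x \in X by apply/fset0Pn; rewrite -cardfs_gt0 ltnW.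
have [y0] : exists y, y \in (X `\ x0)%fset.
  by apply/fset0Pn; rewrite -cardfs_gt0; move: X1; rewrite (cardfsD1 x0) x0X.
rewrite !inE => /andP[y0x0 y0X].
pose p0 : X * X := ([` x0X]%fset, [` y0X]%fset).
pose P (p : X * X) := val p.1 != val p.2.
pose F (p : X * X) := euclidean_norm (val p.1 - val p.2).
have P0 : P p0 by rewrite /P /= eq_sym.
have [[a b] /= Pab minab] := @Order.TotalTheory.arg_minP _ R _ p0 P F P0.
exists (val a), (val b); split; [exact: valP|exact: valP|exact: Pab|].
apply/eqP; rewrite eq_le lb ?valP //=.
apply: lb_le_inf; first by exists (F p0), x0, y0; rewrite eq_sym.
move=> _ [x [y [/= xX yX xy ->]]].
exact: (minab ([` xX]%fset, [` yX]%fset)).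
Qed.

Definition evenly_distributed (X : nat -> {fset 'rV[R]_d}) : Prop :=
  [/\ forall i, [set` X i] `<=` euclidean_ball,
      (fun i => #|` X i|) @ \oo --> \oo &
      (fun i => min_dist [set` X i] : R^o) \is
        'Theta_\oo (fun i => #|` X i|%:R `^ (- d%:R^-1) : R^o)].

End Peeling.

(* Main.v *)
Require Import Defs.
From HB Require Import structures.
From mathcomp Require Import all_boot all_order all_algebra finmap.
From mathcomp Require Import ring lra zify.
From mathcomp Require Import all_classical all_reals all_analysis.

Set Implicit Arguments.
Unset Strict Implicit.
Unset Printing Implicit Defensive.

Import Order.TTheory GRing.Theory Num.Theory.
Import numFieldNormedType.Exports.

Local Open Scope classical_set_scope.
Local Open Scope ring_scope.

(** Take the points of R^d whose coordinates are sqrt(a_j / (d m)), with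
    a_j in {0, ..., m}. There are n = (m+1)^d of them, and distinct points differ
    by at least 1 / (2 d m) in some coordinate; the value 1/m bounds the distance
    of two neighbours at the end of an axis. The square roots make all squared
    norms multiples of 1 / (d m), so the points lie on at most d m + 1 spheres
    around the origin, and each peeling step removes at least the points on the
    outermost one: L <= d m + 1. On the other hand m + 1 of the points lie on a
    coordinate axis, and a peeling step removes at most the two outermost points
    of a line: m < 2 L. *)

Lemma Theta_oo_bounds (R : realType) (f g : nat -> R^o) (k1 k2 : R) :
  0 < k1 -> 0 < k2 ->
  (forall i, k1 * `|g i| <= `|f i| <= k2 * `|g i|) -> f \is 'Theta_\oo g.
Proof.
move=> k10 k20 h; rewrite qualifE; apply/asboolP.
exists (k1, k2); first by rewrite /= k10.
by apply: nearW => i /=; apply/andP; exact: h.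
Qed.

(** * The squared Euclidean norm *)

Section Norm.
Context {R : realType} {d : nat}.
Implicit Types x a b : 'rV[R]_d.

(** Free of the square root, so that [ring] and [nra] apply; [euclidean_norm x] unfolds to its
    square root. *)
Definition sqnorm x : R := \sum_(i < d) x 0 i ^+ 2.

Lemma sqnorm_ge0 x : 0 <= sqnorm x.
Proof. by apply: sumr_ge0 => i _; rewrite sqr_ge0. Qed.

Lemma sqnorm_le0 x : sqnorm x <= 0 -> x = 0.
Proof.
move=> qx0; have /eqP : sqnorm x = 0 by apply/eqP; rewrite eq_le qx0 sqnorm_ge0.
rewrite psumr_eq0 => [/allP h|i _]; last by rewrite sqr_ge0.
apply/rowP => i; rewrite mxE; apply/eqP.
by have := h i (mem_index_enum _); rewrite /= sqrf_eq0.
Qed.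

(** Strict convexity in exact form: the last term is the deficit, positive for 0 < t < 1 unless a =
    b. *)
Lemma sqnorm_conv a b t :
  sqnorm (t *: a + (1 - t) *: b) =
  t * sqnorm a + (1 - t) * sqnorm b - t * (1 - t) * sqnorm (a - b).
Proof.
rewrite /sqnorm !mulr_sumr -big_split -sumrB /=; apply: eq_bigr => i _.
rewrite !mxE; ring.
Qed.

Lemma ler_coord_euclidean_norm x j : `|x 0 j| <= euclidean_norm x.
Proof.
rewrite -sqrtr_sqr ler_sqrt ?sqnorm_ge0//.
by rewrite (bigD1 j)//= lerDl; apply: sumr_ge0 => i _; rewrite sqr_ge0.
Qed.

Lemma euclidean_norm_delta (c : R) (j : 'I_d) :
  euclidean_norm (c *: delta_mx 0 j : 'rV_d) = `|c|.
Proof.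
rewrite /euclidean_norm (bigD1 j)//= !mxE !eqxx mulr1 big1 ?addr0 ?sqrtr_sqr//.
by move=> i /negPf ij; rewrite !mxE ij /= mulr0 expr0n.
Qed.

End Norm.

(** * Upper and lower bounds for peeling *)

Section Peel.
Context {R : realType} {d : nat}.
Implicit Types X Y : {fset 'rV[R]_d}.

(** The centred ball with y on its boundary contains Y, hence its hull, and no boundary point of a
    ball lies strictly inside a segment of the ball. *)
Lemma sqnorm_max_hull_vertex Y y : y \in Y ->
  (forall z, z \in Y -> sqnorm z <= sqnorm y) -> hull_vertices Y y.
Proof.
move=> yY ymax.
have sub : convex_hull [set` Y] `<=` [set z | sqnorm z <= sqnorm y].
  apply: smallest_sub => [|z /ymax//] a b l.
  rewrite !inE /= => qa qb; rewrite /conv /= sqnorm_conv.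
  have l0 : 0 <= l%:num by [].
  have l1 : l%:num <= 1 by [].
  have := mulr_ge0 (mulr_ge0 l0 (_ : 0 <= 1 - l%:num)) (sqnorm_ge0 (a - b)).
  rewrite subr_ge0 => /(_ l1); move: (sqnorm (a - b)) => z; nra.
split; first exact: sub_gen_smallest.
move=> a b t /sub /= qa /sub /= qb /andP[t0 t1] e.
suff ab : a = b by move: e; rewrite ab -scalerDl addrC subrK scale1r => ->.
apply/eqP; rewrite -subr_eq0; apply/eqP; apply: sqnorm_le0.
(* Since a and b are no longer than y, the deficit t (1 - t) [sqnorm (a - b)] is at most 0. *)
have := sqnorm_conv a b t; rewrite -e => qm.
have tt : 0 < t * (1 - t) by rewrite mulr_gt0// subr_gt0.
rewrite -(pmulr_rle0 _ tt); nra.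
Qed.

(** Induction on the number K of admissible spheres, some possibly empty: points on the outermost
    one have maximal norm, so a single step removes them all. *)
Lemma iter_peel_eq0 (c : R) (K : nat) Y : 0 <= c ->
  (forall y, y \in Y -> exists2 s, (s < K)%N & sqnorm y = s%:R * c) ->
  iter K peel Y = fset0.
Proof.
move=> c0; elim: K Y => [|K IH] Y hY.
  by apply/eqP; rewrite -[_ == _]negbK; apply/fset0Pn => -[y /hY[]].
rewrite iterSr; apply: IH => y; rewrite !inE /= => /andP[yY yV].
have [s] := hY y yY; rewrite ltnS leq_eqVlt => /predU1P[-> qy|sK qy].
- case/negP: yV; rewrite inE; apply: sqnorm_max_hull_vertex => // z zY.
  have [s' s'K ->] := hY z zY; rewrite qy.
  by rewrite ler_wpM2r// ler_nat -ltnS.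
- by exists s.
Qed.

Lemma mem_iter_peel Y (p : nat -> 'rV[R]_d) (m : nat) :
  (forall j, (j <= m)%N -> p j \in Y) ->
  (forall j, (j.+2 <= m)%N -> exists2 t : R, 0 < t < 1 &
     p j.+1 = t *: p j + (1 - t) *: p j.+2 /\ p j != p j.+1) ->
  forall n j, (n <= j)%N -> (j + n <= m)%N -> p j \in iter n peel Y.
Proof.
(* After n steps the points n, ..., m - n survive, so each point of
   n+1, ..., m - n - 1 still lies strictly between two neighbours. *)
move=> pY pc; elim=> [|n IH] [|j]//=; rewrite ?addn0.
- by move=> _ h; exact: pY.
- by move=> _ h; exact: pY.
move=> nj jn; rewrite !inE /=; apply/andP; split; first by apply: IH; lia.
apply/negP; rewrite inE => -[_ ext].
have [|t t01 [e /negP ne]] := pc j; first lia.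
apply: ne; apply/eqP.
by have [] := ext _ _ _ _ _ t01 e => //; apply: sub_gen_smallest; apply: IH; lia.
Qed.

Lemma layer_numberP X : iter (layer_number X) peel X = fset0.
Proof. by rewrite /layer_number; case: ex_minnP => n /eqP. Qed.

Lemma layer_number_le X n : iter n peel X = fset0 -> (layer_number X <= n)%N.
Proof. by rewrite /layer_number; case: ex_minnP => k _ h /eqP /h. Qed.

End Peel.

(** * The grid of square roots *)

Section SqrtGrid.
Context {R : realType} (d m : nat).
Hypotheses (d_gt0 : (0 < d)%N) (m_gt0 : (0 < m)%N).

Definition sqrt_node (a : nat) : R := Num.sqrt (a%:R / (d * m)%:R).

Definition sqrt_point (a : {ffun 'I_d -> 'I_m.+1}) : 'rV[R]_d :=
  \row_j sqrt_node (a j).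

Definition sqrt_grid : {fset 'rV[R]_d} :=
  [fset sqrt_point a | a in {: {ffun 'I_d -> 'I_m.+1}}]%fset.

Let c_gt0 : 0 < (d * m)%:R :> R.
Proof. by rewrite ltr0n muln_gt0 d_gt0. Qed.

Lemma sqrt_node_ge0 a : 0 <= sqrt_node a.
Proof. exact: sqrtr_ge0. Qed.

Lemma sqr_sqrt_node a : sqrt_node a ^+ 2 = a%:R / (d * m)%:R.
Proof. by rewrite sqr_sqrtr// divr_ge0. Qed.

Lemma sqrt_node_le1 a : (a <= m)%N -> sqrt_node a <= 1.
Proof.
move=> am; rewrite -(ler_pXn2r (ltn0Sn 1)) ?nnegrE ?sqrt_node_ge0//.
rewrite sqr_sqrt_node expr1n ler_pdivrMr// mul1r ler_nat.
by rewrite (leq_trans am)// leq_pmull.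
Qed.

Lemma sqrt_node_lt a b : (a < b)%N -> sqrt_node a < sqrt_node b.
Proof.
move=> ab; rewrite -(ltr_pXn2r (ltn0Sn 1)) ?nnegrE ?sqrt_node_ge0//.
by rewrite !sqr_sqrt_node ltr_pM2r ?invr_gt0// ltr_nat.
Qed.

(** The squares differ by at least 1 / (d m), and the sum of the two nodes is at most 2. *)
Lemma sqrt_node_dist_ge a b : (a < b)%N -> (b <= m)%N ->
  (2 * (d * m)%:R)^-1 <= sqrt_node b - sqrt_node a.
Proof.
move=> ab bm.
have a1 : sqrt_node a <= 1 by apply: sqrt_node_le1; lia.
have b1 := sqrt_node_le1 bm.
have lt := sqrt_node_lt ab.
have : (d * m)%:R^-1 <= sqrt_node b ^+ 2 - sqrt_node a ^+ 2.
  rewrite !sqr_sqrt_node -mulrBl ler_peMl ?invr_ge0// -natrB ?(ltnW ab)//.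
  by rewrite ler1n subn_gt0.
rewrite invfM; nra.
Qed.

(** The squares differ by exactly 1 / (d m), and the sum of the two nodes is at least 1 / d. *)
Lemma sqrt_node_dist_le : sqrt_node m - sqrt_node m.-1 <= m%:R^-1.
Proof.
have m0 : 0 < m%:R :> R by rewrite ltr0n.
have lt : sqrt_node m.-1 < sqrt_node m by apply: sqrt_node_lt; lia.
have e : sqrt_node m ^+ 2 - sqrt_node m.-1 ^+ 2 = (d * m)%:R^-1.
  rewrite !sqr_sqrt_node -mulrBl -natrB ?leq_pred//.
  by rewrite (_ : m - m.-1 = 1)%N ?mul1r//; lia.
(* The last node is 1 / sqrt d, and d >= 1. *)
have dm : d%:R^-1 <= sqrt_node m.
  rewrite -(ler_pXn2r (ltn0Sn 1)) ?nnegrE ?sqrt_node_ge0 ?invr_ge0//.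
  rewrite sqr_sqrt_node natrM invfM mulrCA divff ?lt0r_neq0// mulr1.
  by rewrite expr2 ler_piMr ?invr_ge0 ?invf_le1 ?ler1n ?ltr0n.
have := sqrt_node_ge0 m.-1.
have d0 : 0 < d%:R^-1 :> R by rewrite invr_gt0 ltr0n.
move: e; rewrite natrM invfM; set v := m%:R^-1; nra.
Qed.

Lemma sqnorm_sqrt_point a :
  sqnorm (sqrt_point a) = (\sum_j a j)%:R * (d * m)%:R^-1.
Proof.
rewrite natr_sum mulr_suml; apply: eq_bigr => j _.
by rewrite mxE sqr_sqrt_node.
Qed.

Lemma sum_ffun_le (a : {ffun 'I_d -> 'I_m.+1}) : (\sum_j a j <= d * m)%N.
Proof.
rewrite -[X in (_ <= X * _)%N](card_ord d) -sum_nat_const.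
by apply: leq_sum => j _; rewrite -ltnS.
Qed.

Lemma sqrt_point_dist_ge a b : a != b ->
  (2 * (d * m)%:R)^-1 <= euclidean_norm (sqrt_point a - sqrt_point b).
Proof.
move=> ab; have [j abj] : exists j, a j != b j.
  apply/existsP; rewrite -negb_forall; apply: contra ab => /forallP ab.
  by apply/eqP/ffunP => j; apply/eqP.
apply: le_trans (ler_coord_euclidean_norm _ j); rewrite !mxE.
have := ltn_ord (a j); have := ltn_ord (b j); rewrite !ltnS => bm am.
have [ltab|ltba|e] := ltngtP (a j) (b j).
- by rewrite distrC; apply: le_trans (ler_norm _); exact: sqrt_node_dist_ge.
- by apply: le_trans (ler_norm _); exact: sqrt_node_dist_ge.
- by move: abj; rewrite -val_eqE /= e eqxx.
Qed.

Lemma sqrt_point_inj : injective sqrt_point.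
Proof.
move=> a b e; apply/eqP/negPn/negP => /sqrt_point_dist_ge.
rewrite e subrr leNgt => /negP; apply.
rewrite (_ : euclidean_norm 0 = 0) ?invr_gt0 ?mulr_gt0//.
rewrite /euclidean_norm big1 ?sqrtr0// => j _.
by rewrite mxE expr0n.
Qed.

Lemma card_sqrt_grid : #|` sqrt_grid| = (m.+1 ^ d)%N.
Proof.
rewrite card_imfset; last exact: sqrt_point_inj.
by rewrite /= -cardE card_ffun !card_ord.
Qed.

Lemma sqrt_grid_ball : [set` sqrt_grid] `<=` euclidean_ball.
Proof.
move=> _ /imfsetP[a _ ->] /=; rewrite /euclidean_ball /=.
rewrite -sqrtr1 ler_sqrt// -/(sqnorm _) sqnorm_sqrt_point.
by rewrite ler_pdivrMr// mul1r ler_nat sum_ffun_le.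
Qed.

(** * Grid points on one axis, minimum distance and layer number *)

Let j0 : 'I_d := Ordinal d_gt0.

(** For k > m, [inord k] falls back to 0 and the point is the origin; thus membership in the grid
    holds for all k, while the other facts assume k <= m. *)
Let axis (k : nat) : 'rV[R]_d :=
  sqrt_point [ffun j => if j == j0 then inord k else ord0].

Let axis_grid k : axis k \in sqrt_grid.
Proof. by apply/imfsetP; eexists. Qed.

Let axisE k : (k <= m)%N -> axis k = sqrt_node k *: delta_mx 0 j0.
Proof.
move=> km; apply/rowP => j; rewrite !mxE ffunE eqxx /=.
case: eqP => _; first by rewrite inordK// mulr1.
by rewrite /sqrt_node mul0r sqrtr0 mulr0.
Qed.

Let axis_neq k l : (k < l)%N -> (l <= m)%N -> axis k != axis l.
Proof.
move=> kl lm; apply/eqP => /(congr1 (fun x : 'rV_d => x 0 j0)).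
rewrite !axisE ?mxE ?eqxx//= ?mulr1; last lia.
by move=> e; have := sqrt_node_lt kl; rewrite e ltxx.
Qed.

Lemma min_dist_sqrt_grid :
  (2 * (d * m)%:R)^-1 <= min_dist [set` sqrt_grid] <= m%:R^-1.
Proof.
have X1 : (1 < #|` sqrt_grid|)%N.
  by rewrite card_sqrt_grid -[X in (X < _)%N](expn0 m.+1) ltn_exp2l.
have [[x [y [+ + xy dxy]]] hle] := min_distE X1.
move=> /imfsetP[a _ ex] /imfsetP[b _ ey]; apply/andP; split.
  rewrite dxy ex ey; apply: sqrt_point_dist_ge.
  by apply: contraNneq xy => ab; rewrite ex ey ab.
have mm : (m.-1 < m)%N by lia.
apply: le_trans sqrt_node_dist_le.
apply: le_trans (hle _ _ (axis_grid m) (axis_grid m.-1) _) _.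
  by rewrite eq_sym axis_neq.
rewrite !axisE ?leq_pred// -scalerBl euclidean_norm_delta ger0_norm//.
by rewrite subr_ge0 ltW// sqrt_node_lt.
Qed.

Lemma layer_number_sqrt_grid :
  (m < 2 * layer_number sqrt_grid)%N /\ (layer_number sqrt_grid <= (d * m).+1)%N.
Proof.
split; last first.
  apply: layer_number_le; apply: (@iter_peel_eq0 _ _ (d * m)%:R^-1).
    by rewrite invr_ge0.
  move=> _ /imfsetP[a _ ->]; exists (\sum_j a j)%N; last exact: sqnorm_sqrt_point.
  by rewrite ltnS sum_ffun_le.
(* If 2 L <= m, the axis point of index L would survive L steps, after which nothing is left. *)
rewrite ltnNge; apply/negP => Lm; set L := layer_number _ in Lm.
suff : axis L \in iter L peel sqrt_grid by rewrite layer_numberP.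
apply: (@mem_iter_peel _ _ _ _ m) => //; last by rewrite addnn -mul2n.
move=> j jm.
have lt01 : sqrt_node j < sqrt_node j.+1 by exact: sqrt_node_lt.
have lt12 : sqrt_node j.+1 < sqrt_node j.+2 by exact: sqrt_node_lt.
have lt02 := lt_trans lt01 lt12.
set u := sqrt_node j in lt01 lt02; set v := sqrt_node j.+1 in lt01 lt12.
set w := sqrt_node j.+2 in lt12 lt02.
have wu : 0 < w - u by rewrite subr_gt0.
(* The solution t of v = t u + (1 - t) w. *)
exists ((w - v) / (w - u)).
  by rewrite divr_gt0 ?subr_gt0//= ltr_pdivrMr// mul1r ltrD2l ltrN2.
split; last by rewrite axis_neq//; lia.
rewrite !axisE; [|lia..]; rewrite !scalerA -scalerDl -/u -/v -/w.
by congr (_ *: _); field; rewrite lt0r_neq0.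
Qed.

End SqrtGrid.

(** * The asymptotic bounds *)

Theorem proposition1p5 (R : realType) (d : nat) (hd : (1 <= d)%N) :
  exists X : nat -> {fset 'rV[R]_d},
    evenly_distributed X /\
    (fun i => (layer_number (X i))%:R : R^o) \is
      'Theta_\oo (fun i => #|` X i|%:R `^ (d%:R^-1) : R^o).
Proof.
have d0 : d%:R != 0 :> R by rewrite pnatr_eq0 -lt0n.
have d1 : 1 <= d%:R :> R by rewrite ler1n.
have cardE i : #|` @sqrt_grid R d i.+1| = (i.+2 ^ d)%N by exact: card_sqrt_grid.
(* With m = i + 1, which keeps m positive, the d-th root of the cardinality is exactly m + 1. *)
have rootE i : (#|` @sqrt_grid R d i.+1|%:R : R) `^ d%:R^-1 = i.+2%:R.
  by rewrite cardE natrX -powR_mulrn// -powRrM divff// powRr1.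
exists (fun i => sqrt_grid d i.+1); split; first split.
- by move=> i; exact: sqrt_grid_ball.
- apply/cvgnyPge => A; near=> i; rewrite cardE.
  apply: (@leq_trans i.+2); last by rewrite -[leqLHS]expn1 leq_exp2l.
  by apply: leq_trans (leq_trans (leqnSn _) (leqnSn _)); near: i; exact: nbhs_infty_ge.
(* From 1 / (2 d m) >= 1 / (2 d (m + 1)) and 1 / m <= 2 / (m + 1). *)
- apply: (@Theta_oo_bounds _ _ _ (2 * d%:R)^-1 2) => [||i] //.
    by rewrite invr_gt0 mulr_gt0// ltr0n.
  rewrite powRN rootE.
  have /andP[lo hi] := @min_dist_sqrt_grid R d i.+1 hd isT.
  have min0 : 0 <= min_dist [set` @sqrt_grid R d i.+1].
    by apply: le_trans lo; rewrite invr_ge0 mulr_ge0.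
  rewrite !ger0_norm ?invr_ge0//; apply/andP; split.
    apply: le_trans lo; rewrite natrM mulrA [leRHS]invfM ler_wpM2l//.
    by rewrite lef_pV2 ?posrE ?ltr0n// ler_nat.
  apply: le_trans hi _; rewrite -[leLHS]mul1r ler_pdivrMr ?ltr0n// mulrAC.
  by rewrite ler_pdivlMr ?ltr0n// mul1r -natrM ler_nat; lia.
(* From m < 2 L follows (m + 1) / 4 <= L with room to spare; above, d m + 1 <= d (m + 1). *)
- apply: (@Theta_oo_bounds _ _ _ 4^-1 d%:R) => [||i] //.
    by rewrite ltr0n.
  have [lo hi] := @layer_number_sqrt_grid R d i.+1 hd isT.
  rewrite rootE !ger0_norm//; apply/andP; split.
    by rewrite ler_pdivrMl// -natrM ler_nat; lia.
  by rewrite -natrM ler_nat; apply: leq_trans hi _; rewrite [leqRHS]mulnS; lia.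
Unshelve. all: by end_near. Qed.
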